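(* Let $Y = \zeta_u(u,v)\,\partial_u+\zeta_v(u,v)\,\partial_v$ be a smooth vector field on $M_2$ that generates a symmetry of the phase plane equation $$v' = \frac{dv}{du} = \Omega(u,v),\qquad \Omega(u,v)=\frac{\omega_v(u,v)}{\omega_u(u,v)},$$ and let $\hat Y = \xi(t,u,v)\,\partial_t + Y$ be a lift of $Y$ to $M_3$, with $\xi$ a smooth function on $M_3$. Then $\hat Y$ generates a symmetry of the autonomous system $$\dot u=\omega_u(u,v),\qquad \dot v=\omega_v(u,v)$$ if and only if $$\left.\left(D_t\xi\right)\right|_{\Delta} = \frac{1}{\omega_u}\Big(\left(\omega_u\partial_u+\omega_v\partial_v\right)\zeta_u - \left(\zeta_u\partial_u+\zeta_v\partial_v\right)\omega_u\Big),$$ where $\left.(D_t\xi)\right|_\Delta = \partial_t\xi+\omega_u\partial_u\xi+\omega_v\partial_v\xi$.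
   Context: Let $U\subseteq\mathbb{R}^2$ be open with coordinates $(u,v)$, and let $\omega_u,\omega_v : U\to\mathbb{R}$ be smooth with $\omega_u(u,v)\neq 0$ on $U$ (subscripts on $\omega,\eta,\zeta$ are labels, not derivatives). Put $M_2 = U$, $M_3=\mathbb{R}\times U$ with coordinates $(t,u,v)$, $J_5 = M_3\times\mathbb{R}^2$ with coordinates $(t,u,v,\dot u,\dot v)$, and $J_3 = M_2\times\mathbb{R}$ with coordinates $(u,v,v')$. Let $\Delta\subset J_5$ be the subset where $\dot u=\omega_u(u,v)$ and $\dot v=\omega_v(u,v)$, and $\delta\subset J_3$ the subset where $v'=\Omega(u,v)$. Time domain: the prolongation of a vector field $X = \xi(t,u,v)\partial_t+\eta_u(u,v)\partial_u+\eta_v(u,v)\partial_v$ on $M_3$ is $$X^{(1)} = X + \eta_u^{(1)}\partial_{\dot u} + \eta_v^{(1)}\partial_{\dot v},\quad \eta_u^{(1)} = D_t\eta_u - \dot u D_t\xi,\quad \eta_v^{(1)} = D_t\eta_v - \dot v D_t\xi,\quad D_t = \partial_t+\dot u\partial_u+\dot v\partial_v .$$ $X$ generates a symmetry of the system if $$X^{(1)}(\dot u-\omega_u)\big|_\Delta = 0 \quad\text{and}\quad X^{(1)}(\dot v-\omega_v)\big|_\Delta = 0 .$$ Phase plane: the prolongation of $Y = \zeta_u(u,v)\partial_u+\zeta_v(u,v)\partial_v$ on $M_2$ is $$Y^{(1)} = Y + \zeta_v^{(1)}\partial_{v'},\quad \zeta_v^{(1)} = D_u\zeta_v - v' D_u\zeta_u,\quad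 D_u = \partial_u+v'\partial_v .$$ $Y$ generates a symmetry of $v'=\Omega(u,v)$ if $Y^{(1)}(v'-\Omega)\big|_\delta = 0$. *)

(* Defs.v *)
From HB Require Import structures.
From mathcomp Require Import all_boot all_order all_algebra.
From mathcomp Require Import all_classical all_reals all_analysis.
Set Implicit Arguments.
Unset Strict Implicit.
Unset Printing Implicit Defensive.
Import Order.TTheory GRing.Theory Num.Theory.
Import numFieldNormedType.Exports.
Local Open Scope classical_set_scope.
Local Open Scope ring_scope.

(* Points are row vectors of coordinates; coordinate labels are read off as   *)
(*   M2 : (u, v)      = (p 0 0, p 0 1)                                        *)
(*   J3 : (u, v, v')  = (p 0 0, p 0 1, p 0 2)                                 *)
(*   M3 : (t, u, v)   = (p 0 0, p 0 1, p 0 2)                                 *)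
(*   J5 : (t, u, v, udot, vdot) = (p 0 0, ..., p 0 4)                         *)
(* where the numerals denote elements of the relevant ordinal type.  Functions *)
(* are total on the ambient R^n; only their values on the (open) domain built *)
(* from U are ever constrained.                                               *)

Definition pd (R : realType) (n : nat) (i : 'I_n) (f : 'rV[R]_n -> R)
  (x : 'rV[R]_n) : R := 'D_(delta_mx 0 i) f x.

Fixpoint Cn_on (R : realType) (n k : nat) (A : set 'rV[R]_n)
    (f : 'rV[R]_n -> R) : Prop :=
  (forall x, A x -> {for x, continuous f}) /\
  (if k is k'.+1 then
     forall i : 'I_n, (forall x, A x -> derivable f x (delta_mx 0 i)) /\
                      Cn_on k' A (pd i f)
   else True).

(* C^infinity on an open set A *)
Definition smooth_on (R : realType) (n : nat) (A : set 'rV[R]_n)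
  (f : 'rV[R]_n -> R) : Prop := forall k, Cn_on k A f.

(* A vector field X = \sum_i X_i d/dx_i is encoded by its coefficient row.    *)
Definition vfield (R : realType) (n : nat) := 'rV[R]_n -> 'rV[R]_n.

Definition vact (R : realType) (n : nat) (X : vfield R n)
  (f : 'rV[R]_n -> R) (p : 'rV[R]_n) : R := \sum_(i < n) X p 0 i * pd i f p.

Definition rowseq (R : realType) (n : nat) (s : seq R) : 'rV[R]_n :=
  \row_(i < n) s`_i.

Definition vf2 (R : realType) (a b : 'rV[R]_2 -> R) : vfield R 2 :=
  fun p => rowseq 2 [:: a p; b p].

Section PhasePlane.
Variables (R : realType) (U : set 'rV[R]_2).

Definition J3_M2 (p : 'rV[R]_3) : 'rV[R]_2 := rowseq 2 [:: p 0 0; p 0 1].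

Definition Du (f : 'rV[R]_2 -> R) (p : 'rV[R]_3) : R :=
  pd 0 f (J3_M2 p) + p 0 2 * pd 1 f (J3_M2 p).

Definition phase_prolong (Y : vfield R 2) : vfield R 3 := fun p =>
  let zeta_u q := Y q 0 0 in
  let zeta_v q := Y q 0 1 in
  rowseq 3 [:: zeta_u (J3_M2 p); zeta_v (J3_M2 p);
               Du zeta_v p - p 0 2 * Du zeta_u p].

Definition phase_locus (Omega : 'rV[R]_2 -> R) : set 'rV[R]_3 :=
  [set p | U (J3_M2 p) /\ p 0 2 = Omega (J3_M2 p)].

Definition phase_symmetry (Omega : 'rV[R]_2 -> R) (Y : vfield R 2) : Prop :=
  forall p, phase_locus Omega p ->
    vact (phase_prolong Y) (fun q => q 0 2 - Omega (J3_M2 q)) p = 0.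

End PhasePlane.

Section TimeDomain.
Variables (R : realType) (U : set 'rV[R]_2).

Definition M3_M2 (q : 'rV[R]_3) : 'rV[R]_2 := rowseq 2 [:: q 0 1; q 0 2].

Definition J5_M3 (p : 'rV[R]_5) : 'rV[R]_3 :=
  rowseq 3 [:: p 0 0; p 0 1; p 0 2].

Definition J5_M2 (p : 'rV[R]_5) : 'rV[R]_2 := M3_M2 (J5_M3 p).

Definition M3 : set 'rV[R]_3 := [set q | U (M3_M2 q)].

Definition Dt (f : 'rV[R]_3 -> R) (p : 'rV[R]_5) : R :=
  pd 0 f (J5_M3 p) + p 0 3 * pd 1 f (J5_M3 p) + p 0 4 * pd 2 f (J5_M3 p).

Definition time_prolong (X : vfield R 3) : vfield R 5 := fun p =>
  let xi q := X q 0 0 in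
  let eta_u q := X q 0 1 in
  let eta_v q := X q 0 2 in
  rowseq 5 [:: xi (J5_M3 p); eta_u (J5_M3 p); eta_v (J5_M3 p);
               Dt eta_u p - p 0 3 * Dt xi p;
               Dt eta_v p - p 0 4 * Dt xi p].

Definition time_locus (omega_u omega_v : 'rV[R]_2 -> R) : set 'rV[R]_5 :=
  [set p | U (J5_M2 p) /\
           p 0 3 = omega_u (J5_M2 p) /\ p 0 4 = omega_v (J5_M2 p)].

Definition time_symmetry (omega_u omega_v : 'rV[R]_2 -> R) (X : vfield R 3)
    : Prop :=
  (forall p, time_locus omega_u omega_v p ->
     vact (time_prolong X) (fun q => q 0 3 - omega_u (J5_M2 q)) p = 0) /\
  (forall p, time_locus omega_u omega_v p ->
     vact (time_prolong X) (fun q => q 0 4 - omega_v (J5_M2 q)) p = 0).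

(* xi d/dt + Y, with Y pulled back along (t, u, v) |-> (u, v) *)
Definition vlift (xi : 'rV[R]_3 -> R) (Y : vfield R 2) : vfield R 3 := fun q =>
  rowseq 3 [:: xi q; Y (M3_M2 q) 0 0; Y (M3_M2 q) 0 1].

End TimeDomain.

(* Main.v *)
Require Import Defs.
From HB Require Import structures.
From mathcomp Require Import all_boot all_order all_algebra.
From mathcomp Require Import all_classical all_reals all_analysis.
From mathcomp Require Import ring.
Import Order.TTheory GRing.Theory Num.Theory.
Import numFieldNormedType.Exports.
Local Open Scope classical_set_scope.
Local Open Scope ring_scope.

(** The symmetry conditions are bracket conditions.  Write
    A = omega_u d/du + omega_v d/dv for the field of the system.  On the locus
    the total derivative of a function of (u, v) is its derivative along A, so
    the two time-domain conditions say, component by component, that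
    [A, Y] = (D_t xi) A ([time_residual_u], [time_residual_v]).  On the phase
    locus D_u is omega_u^-1 A, and the quotient rule turns the phase plane
    condition into [A, Y]_v = Omega [A, Y]_u, that is, into [A, Y] being
    proportional to A ([phase_residual], [phase_symmetry_bracket]).

    So for a symmetry Y of the phase plane equation the v-component of
    [A, Y] = (D_t xi) A follows from its u-component, and the u-component,
    divided by the nonvanishing omega_u, is the asserted formula for D_t xi.

    Every function differentiated on a jet space is a function of the base
    composed with a linear projection.  A directional derivative of such a
    composite is, difference quotient by difference quotient, a directional
    derivative downstairs, so partial derivatives of first order suffice and
    no differentiability in the sense of Frechet is involved. *)

(** * Directional derivatives through linear maps *)

Section LinearPullback.
Context {R : realType} {V V' W : normedModType R} {L : V -> V'}.
Hypothesis L_lin : forall (a : R) x y, L (a *: x + y) = a *: L x + L y.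

Lemma diff_quotient_comp (f : V' -> W) p v :
  (fun h : R => h^-1 *: (f (L (h *: v + p)) - f (L p))) =
  (fun h : R => h^-1 *: (f (h *: L v + L p) - f (L p))).
Proof. by apply/funext => h; rewrite L_lin. Qed.

(** Both sides are limits of the same difference quotient, so the equation
    holds whether or not f is derivable. *)
Lemma derive_comp_lin (f : V' -> W) p v :
  'D_v (fun q => f (L q)) p = 'D_(L v) f (L p).
Proof. by rewrite /derive /= diff_quotient_comp. Qed.

Lemma derivable_comp_lin (f : V' -> W) p v :
  derivable f (L p) (L v) -> derivable (fun q => f (L q)) p v.
Proof. by rewrite /derivable /= diff_quotient_comp. Qed.

End LinearPullback.

Lemma coord_lin (R : realType) n (k : 'I_n) (a : R) (x y : 'rV[R]_n) :
  (a *: x + y) 0 k = a *: (x 0 k : R^o) + y 0 k.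
Proof. by rewrite !mxE. Qed.

Lemma derive_coord (R : realType) n (k : 'I_n.+1) (p v : 'rV[R]_n.+1) :
  'D_v (fun q : 'rV[R]_n.+1 => q 0 k) p = v 0 k.
Proof.
have /= -> := derive_comp_lin (coord_lin _ _ k) (id : R^o -> R^o) p v.
by rewrite derive_id.
Qed.

Lemma derivable_coord (R : realType) n (k : 'I_n.+1) (p v : 'rV[R]_n.+1) :
  derivable (fun q : 'rV[R]_n.+1 => q 0 k) p v.
Proof.
apply: (derivable_comp_lin (coord_lin _ _ k) (id : R^o -> R^o)).
exact: derivable_id.
Qed.

(** All three equations of the problem have this shape, a jet coordinate
    against a function of the base, so one computation serves both the time
    domain and the phase plane. *)
Lemma vact_coord_sub (R : realType) n m (Z : vfield R n.+1) (k : 'I_n.+1)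
    (L : 'rV[R]_n.+1 -> 'rV[R]_m) (f : 'rV[R]_m -> R) p :
  (forall (a : R) x y, L (a *: x + y) = a *: L x + L y) ->
  (forall i, derivable f (L p) (L (delta_mx 0 i))) ->
  vact Z (fun q => q 0 k - f (L q)) p =
  Z p 0 k - \sum_(i < n.+1) Z p 0 i * 'D_(L (delta_mx 0 i)) f (L p).
Proof.
move=> L_lin df; rewrite /vact.
under eq_bigr => i _.
  rewrite /pd deriveB; [|exact: derivable_coord|exact: derivable_comp_lin].
  rewrite derive_coord derive_comp_lin // mxE eqxx mulrBr.
  over.
rewrite /= sumrB (bigD1 k) //= eqxx mulr1 big1 ?addr0 // => i ik.
by rewrite eq_sym (negbTE ik) mulr0.
Qed.

(** * The projections between the jet spaces *)

Lemma sum2 (R : realType) (F : 'I_2 -> R) : \sum_i F i = F 0 + F 1.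
Proof.
rewrite !big_ord_recl big_ord0 addr0; do ?congr (_ + _); congr F; exact: val_inj.
Qed.

Lemma sum3 (R : realType) (F : 'I_3 -> R) : \sum_i F i = F 0 + F 1 + F 2.
Proof.
rewrite !big_ord_recl big_ord0 addr0 !addrA.
by do ?congr (_ + _); congr F; apply: val_inj.
Qed.

Lemma sum5 (R : realType) (F : 'I_5 -> R) :
  \sum_i F i = F 0 + F 1 + F 2 + F 3 + F 4.
Proof.
rewrite !big_ord_recl big_ord0 addr0 !addrA.
by do ?congr (_ + _); congr F; apply: val_inj.
Qed.

Lemma rowseqE (R : realType) n (s : seq R) i : rowseq n s 0 i = s`_i.
Proof. by rewrite mxE. Qed.

Lemma row2P (R : realType) (x y : 'rV[R]_2) :
  x 0 0 = y 0 0 -> x 0 1 = y 0 1 -> x = y.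
Proof.
move=> e0 e1; apply/rowP => -[[|[|//]] hi].
  by rewrite (_ : Ordinal hi = 0) //; apply: val_inj.
by rewrite (_ : Ordinal hi = 1) //; apply: val_inj.
Qed.

Lemma J3_M2_lin (R : realType) (a : R) x y :
  J3_M2 (a *: x + y) = a *: J3_M2 x + J3_M2 y.
Proof. by apply: row2P; rewrite !mxE. Qed.

Lemma M3_M2_lin (R : realType) (a : R) x y :
  M3_M2 (a *: x + y) = a *: M3_M2 x + M3_M2 y.
Proof. by apply: row2P; rewrite !mxE. Qed.

Lemma J5_M2_lin (R : realType) (a : R) x y :
  J5_M2 (a *: x + y) = a *: J5_M2 x + J5_M2 y.
Proof. by apply: row2P; rewrite !mxE. Qed.

Lemma J3_M2_delta (R : realType) (i : 'I_3) :
  J3_M2 (delta_mx 0 i) = rowseq 2 [:: (i == 0)%:R; (i == 1)%:R] :> 'rV[R]_2.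
Proof. by apply: row2P; rewrite !mxE /= eq_sym. Qed.

Lemma M3_M2_delta (R : realType) (i : 'I_3) :
  M3_M2 (delta_mx 0 i) = rowseq 2 [:: (i == 1)%:R; (i == 2)%:R] :> 'rV[R]_2.
Proof. by apply: row2P; rewrite !mxE /= eq_sym. Qed.

Lemma J5_M2_delta (R : realType) (i : 'I_5) :
  J5_M2 (delta_mx 0 i) = rowseq 2 [:: (i == 1)%:R; (i == 2)%:R] :> 'rV[R]_2.
Proof. by apply: row2P; rewrite !mxE /= eq_sym. Qed.

Lemma rowseq00 (R : realType) : rowseq 2 [:: 0; 0] = 0 :> 'rV[R]_2.
Proof. by apply: row2P; rewrite !mxE. Qed.

Lemma rowseq10 (R : realType) : rowseq 2 [:: 1; 0] = delta_mx 0 0 :> 'rV[R]_2.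
Proof. by apply: row2P; rewrite !mxE. Qed.

Lemma rowseq01 (R : realType) : rowseq 2 [:: 0; 1] = delta_mx 0 1 :> 'rV[R]_2.
Proof. by apply: row2P; rewrite !mxE. Qed.

Definition rowseq2E := (rowseq00, rowseq10, rowseq01).

(** * The symmetry conditions at a point *)

Lemma vact2 (R : realType) (a b f : 'rV[R]_2 -> R) x :
  vact (vf2 a b) f x = a x * pd 0 f x + b x * pd 1 f x.
Proof. by rewrite /vact sum2 !rowseqE. Qed.

Lemma smooth_derivable (R : realType) n (A : set 'rV[R]_n) f x i :
  smooth_on A f -> A x -> derivable f x (delta_mx 0 i).
Proof. by move=> /(_ 1) /= [_ /(_ i) [df _]]; exact: df. Qed.

(** Directions with 0-1 entries, not both 1, are the ones to which the jet
    spaces' coordinate directions project; derivability along the diagonal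
    would not follow from that along the axes. *)
Lemma derivable_base_dir (R : realType) (f : 'rV[R]_2 -> R) x (a b : bool) :
  ~~ (a && b) -> (forall i, derivable f x (delta_mx 0 i)) ->
  derivable f x (rowseq 2 [:: a%:R; b%:R]).
Proof.
case: a b => -[] //= _ df; rewrite rowseq2E //.
exact: derivable0.
Qed.

Section TimeResiduals.
Context {R : realType} {U : set 'rV[R]_2}.
Context {omega_u omega_v zeta_u zeta_v : 'rV[R]_2 -> R} {xi : 'rV[R]_3 -> R}.

Lemma Dt_locus (f : 'rV[R]_3 -> R) p :
  time_locus U omega_u omega_v p ->
  Dt f p = pd 0 f (J5_M3 p) + omega_u (J5_M2 p) * pd 1 f (J5_M3 p)
           + omega_v (J5_M2 p) * pd 2 f (J5_M3 p).
Proof. by move=> [_ [pu pv]]; rewrite /Dt pu pv. Qed.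

Lemma Dt_pullback (f : 'rV[R]_2 -> R) p :
  time_locus U omega_u omega_v p ->
  Dt (fun q => f (M3_M2 q)) p = vact (vf2 omega_u omega_v) f (J5_M2 p).
Proof.
move=> pD; rewrite (Dt_locus _ _ pD) vact2 /pd.
rewrite !(derive_comp_lin (@M3_M2_lin R)) !M3_M2_delta /= !rowseq2E.
by rewrite derive0 add0r.
Qed.

(** [time_prolong] applies [Dt] to these coefficient functions, which the
    equations turn into pullbacks, ready for [Dt_pullback]. *)
Lemma vlift_coordE :
  ((fun q => vlift xi (vf2 zeta_u zeta_v) q 0 0) = xi) *
  ((fun q => vlift xi (vf2 zeta_u zeta_v) q 0 1) =
    (fun q => zeta_u (M3_M2 q))) *
  ((fun q => vlift xi (vf2 zeta_u zeta_v) q 0 2) =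
    (fun q => zeta_v (M3_M2 q))).
Proof. by do !split; apply/funext => q; rewrite /vlift /vf2 !rowseqE. Qed.

Lemma time_residual (f : 'rV[R]_2 -> R) (k : 'I_5) p :
  smooth_on U f -> U (J5_M2 p) ->
  let X1 := time_prolong (vlift xi (vf2 zeta_u zeta_v)) in
  vact X1 (fun q => q 0 k - f (J5_M2 q)) p =
  X1 p 0 k - vact (vf2 zeta_u zeta_v) f (J5_M2 p).
Proof.
move=> sf Up X1; rewrite vact_coord_sub; last 2 first.
- exact: J5_M2_lin.
- move=> i; rewrite J5_M2_delta; apply: derivable_base_dir.
    by case: eqP => // ->.
  by move=> j; exact: smooth_derivable sf Up.
congr (_ - _); rewrite sum5 !J5_M2_delta /= !rowseq2E !derive0.
rewrite vact2 /X1 /time_prolong /vlift !rowseqE /=.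
by rewrite !mulr0 add0r !addr0.
Qed.

Lemma time_residual_u p :
  smooth_on U omega_u -> time_locus U omega_u omega_v p ->
  vact (time_prolong (vlift xi (vf2 zeta_u zeta_v)))
    (fun q => q 0 3 - omega_u (J5_M2 q)) p =
  vact (vf2 omega_u omega_v) zeta_u (J5_M2 p)
    - vact (vf2 zeta_u zeta_v) omega_u (J5_M2 p) - omega_u (J5_M2 p) * Dt xi p.
Proof.
move=> su pD; have [Up [pu _]] := pD.
rewrite (time_residual _ _ _ su Up) [time_prolong _ _]/time_prolong.
rewrite rowseqE /= !vlift_coordE.
by rewrite (Dt_pullback _ _ pD) pu addrAC.
Qed.

Lemma time_residual_v p :
  smooth_on U omega_v -> time_locus U omega_u omega_v p ->
  vact (time_prolong (vlift xi (vf2 zeta_u zeta_v)))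
    (fun q => q 0 4 - omega_v (J5_M2 q)) p =
  vact (vf2 omega_u omega_v) zeta_v (J5_M2 p)
    - vact (vf2 zeta_u zeta_v) omega_v (J5_M2 p) - omega_v (J5_M2 p) * Dt xi p.
Proof.
move=> sv pD; have [Up [_ pv]] := pD.
rewrite (time_residual _ _ _ sv Up) [time_prolong _ _]/time_prolong.
rewrite rowseqE /= !vlift_coordE.
by rewrite (Dt_pullback _ _ pD) pv addrAC.
Qed.

End TimeResiduals.

Section PhaseResidual.
Context {R : realType} {U : set 'rV[R]_2}.
Context {omega_u omega_v zeta_u zeta_v : 'rV[R]_2 -> R}.
Hypothesis omega_u_neq0 : forall x, U x -> omega_u x != 0.
Hypothesis omega_u_smooth : smooth_on U omega_u.
Hypothesis omega_v_smooth : smooth_on U omega_v.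

Let Omega x := omega_v x / omega_u x.

Lemma Omega_derivable x i : U x -> derivable Omega x (delta_mx 0 i).
Proof.
move=> Ux; apply: derivableM; first exact: smooth_derivable omega_v_smooth Ux.
by apply: derivableV; [exact: omega_u_neq0|exact: smooth_derivable omega_u_smooth Ux].
Qed.

Lemma pd_Omega x i : U x ->
  pd i Omega x = (pd i omega_v x - Omega x * pd i omega_u x) / omega_u x.
Proof.
move=> Ux; have u0 := omega_u_neq0 _ Ux.
have du := smooth_derivable _ _ _ _ _ i omega_u_smooth Ux.
have dv := smooth_derivable _ _ _ _ _ i omega_v_smooth Ux.
rewrite /pd deriveM //; last exact: derivableV.
rewrite deriveV // /Omega /GRing.scale /=.
by field.
Qed.

(** On the locus D_u is omega_u^-1 times the derivative along the field A of
    the system, and the quotient rule for Omega recombines the terms into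
    omega_u^-1 times [A, Y]_v - Omega [A, Y]_u. *)
Lemma phase_residual p : phase_locus U Omega p ->
  let x := J3_M2 p in
  vact (phase_prolong (vf2 zeta_u zeta_v)) (fun q => q 0 2 - Omega (J3_M2 q)) p =
  ((vact (vf2 omega_u omega_v) zeta_v x - vact (vf2 zeta_u zeta_v) omega_v x)
   - Omega x * (vact (vf2 omega_u omega_v) zeta_u x
                - vact (vf2 zeta_u zeta_v) omega_u x)) / omega_u x.
Proof.
move=> [Up pO] x; have u0 := omega_u_neq0 _ Up.
rewrite vact_coord_sub; last 2 first.
- exact: J3_M2_lin.
- move=> i; rewrite J3_M2_delta; apply: derivable_base_dir.
    by case: eqP => // ->.
  by move=> j; exact: Omega_derivable.
have Yu : (fun q => vf2 zeta_u zeta_v q 0 0) = zeta_u.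
  by apply/funext => q; rewrite /vf2 rowseqE.
have Yv : (fun q => vf2 zeta_u zeta_v q 0 1) = zeta_v.
  by apply/funext => q; rewrite /vf2 rowseqE.
rewrite sum3 !J3_M2_delta /= !rowseq2E derive0 mulr0 addr0.
rewrite /phase_prolong Yu Yv !rowseqE /=.
rewrite -[in X in _ - X]/(pd 0 Omega x) -[in X in _ - X]/(pd 1 Omega x).
rewrite !pd_Omega // !vact2 /Du pO /Omega -/x.
by field.
Qed.

End PhaseResidual.

(** * Lifting phase plane symmetries *)

(** Over each point of U the phase locus has exactly one jet, of slope
    omega_v / omega_u, so [phase_residual] can be evaluated there.  The
    resulting proportionality of [A, Y] to A is what makes the v-component of
    the time-domain condition redundant. *)
Lemma phase_symmetry_bracket (R : realType) (U : set 'rV[R]_2)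
    (omega_u omega_v zeta_u zeta_v : 'rV[R]_2 -> R) (x : 'rV[R]_2) :
  smooth_on U omega_u -> smooth_on U omega_v ->
  (forall x, U x -> omega_u x != 0) ->
  phase_symmetry U (fun x => omega_v x / omega_u x) (vf2 zeta_u zeta_v) ->
  U x ->
  vact (vf2 omega_u omega_v) zeta_v x - vact (vf2 zeta_u zeta_v) omega_v x =
  omega_v x / omega_u x *
    (vact (vf2 omega_u omega_v) zeta_u x - vact (vf2 zeta_u zeta_v) omega_u x).
Proof.
move=> su sv u0 hY Ux.
pose p : 'rV[R]_3 := rowseq 3 [:: x 0 0; x 0 1; omega_v x / omega_u x].
have px : J3_M2 p = x by apply: row2P; rewrite !mxE.
have pD : phase_locus U (fun x => omega_v x / omega_u x) p.
  by split; rewrite px // rowseqE.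
have := hY _ pD; rewrite (phase_residual u0 su sv _ pD) px => /eqP.
by rewrite mulf_eq0 invr_eq0 (negbTE (u0 _ Ux)) orbF subr_eq0 => /eqP.
Qed.

Theorem theorem3 (R : realType) (U : set 'rV[R]_2)
    (omega_u omega_v zeta_u zeta_v : 'rV[R]_2 -> R) (xi : 'rV[R]_3 -> R)
    (hU : open U)
    (hsmooth_omega_u : smooth_on U omega_u)
    (hsmooth_omega_v : smooth_on U omega_v)
    (homega_u : forall x, U x -> omega_u x != 0)
    (hsmooth_zeta_u : smooth_on U zeta_u)
    (hsmooth_zeta_v : smooth_on U zeta_v)
    (hY : phase_symmetry U (fun x => omega_v x / omega_u x)
            (vf2 zeta_u zeta_v))
    (hsmooth_xi : smooth_on (M3 U) xi) :
  (time_symmetry U omega_u omega_v (vlift xi (vf2 zeta_u zeta_v)) <->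
   (forall p, time_locus U omega_u omega_v p ->
      Dt xi p =
      (omega_u (J5_M2 p))^-1 *
        (vact (vf2 omega_u omega_v) zeta_u (J5_M2 p) -
         vact (vf2 zeta_u zeta_v) omega_u (J5_M2 p)))) /\
  (forall p, time_locus U omega_u omega_v p ->
     Dt xi p = pd 0 xi (J5_M3 p)
               + omega_u (J5_M2 p) * pd 1 xi (J5_M3 p)
               + omega_v (J5_M2 p) * pd 2 xi (J5_M3 p)).
Proof.
split; last by move=> p; exact: Dt_locus.
split=> [[symu _] p pD | Dxi].
  have u0 := homega_u _ pD.1.
  have := symu _ pD; rewrite (time_residual_u _ hsmooth_omega_u pD) => /eqP.
  by rewrite subr_eq0 => /eqP ->; rewrite mulKf.
split=> p pD; have u0 := homega_u _ pD.1.
  by rewrite (time_residual_u _ hsmooth_omega_u pD) Dxi // mulVKf // subrr.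
rewrite (time_residual_v _ hsmooth_omega_v pD) Dxi //.
rewrite (phase_symmetry_bracket _ _ _ _ _ _ _ hsmooth_omega_u
           hsmooth_omega_v homega_u hY pD.1).
by rewrite mulrA subrr.
Qed.
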